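(* Let $P\subseteq M_{\mathbb{R}}$ be a very ample lattice polytope with $n$ vertices. Then \[k_P\le (m_P-d_P)\cdot n+1.\] The equality occurs if and only if $P$ is normal. Furthermore, if $P$ is not normal, then \[k_P\le (m_P-d_P-1)\cdot n+\nu_P+1.\]
   Context: $M$ is a lattice (free abelian group of finite rank), $M_{\mathbb{R}}=M\otimes\mathbb{R}$, $\mathbb{N}=\{0,1,2,\dots\}$. A lattice polytope is the convex hull of finitely many points of $M$; $kP\cap M$ is the set of lattice points of the dilation $kP$; sums of sets are Minkowski sums. $P$ is very ample if for every vertex $v$ of $P$ the monoid $\mathbb{R}_{\ge 0}(P-v)\cap M$ is generated by $P\cap M-v=\{u-v: u\in P\cap M\}$. $P$ is $k$-normal if every point of $kP\cap M$ is a sum of $k$ points of $P\cap M$; $P$ is normal if it is $k$-normal for all $k\ge 1$. $k_P$ is the smallest positive integer such that $P$ is $k$-normal for all $k\ge k_P$. $d_P$ is the smallest positive integer such that $(k+1)P\cap M=P\cap M+kP\cap M$ for all $k\ge d_P$. With $\mathcal{V}$ the set of vertices of $P$, $\nu_P$ is the smallest positive integer such that $(k+1)P\cap M=\mathcal{V}+kP\cap M$ for all $k\ge \nu_P$. For $P$ very ample, $x\in d_PP\cap M$ and $v$ a vertex of $P$, let \[\sigma(x,d_Pv)=\min\Big\{m\in\mathbb{N}: x-d_Pv=\sum_{i=1}^m(w_i-v)\text{ for some }w_1,\dots,w_m\in P\cap M\Big\},\] and $m_P=\max\{\sigma(x,d_Pv): x\in d_PP\cap M,\ v\text{ a vertex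 of }P\}$.
   Formalization: The polytope is assumed to have at least two vertices; for a single point, n = 1, k_P = d_P = 1 and m_P = 0, so the first bound would read 1 ≤ 0 and the statement fails. *)

(* Defs.v *)
From mathcomp Require Import all_boot all_order all_algebra.
From mathcomp Require Import mathcomp_extra boolp classical_sets functions.
From mathcomp Require Import cardinality reals.

Set Implicit Arguments.
Unset Strict Implicit.
Unset Printing Implicit Defensive.

Import Order.TTheory GRing.Theory Num.Theory.

Local Open Scope classical_set_scope.
Local Open Scope ring_scope.

(* Minimum and maximum of a set of natural numbers; both take the value 0 when
   the set has no minimum (it is empty), resp. no maximum (it is empty or
   unbounded). *)
Definition nat_min (A : set nat) : nat := xget 0%N (A `&` lbound A).
Definition nat_max (A : set nat) : nat := xget 0%N (A `&` ubound A).

Section Polytopes.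
Variables (R : realType) (V : vectType R).
Implicit Types (M P A B : set V) (k d : nat).

(* V plays the role of M_R = M (x) R: a lattice M sits in it as the integral
   span of an R-basis. *)
Definition is_lattice M : Prop :=
  exists2 e : (\dim {:V}).-tuple V,
    basis_of fullv e & M = [set x | inIntSpan e x].

Definition conv A : set V :=
  [set x | exists (m : nat) (s : 'I_m -> V) (a : 'I_m -> R),
     [/\ forall i, A (s i), forall i, 0 <= a i,
         \sum_(i < m) a i = 1 & x = \sum_(i < m) a i *: s i]].

Definition is_lattice_polytope M P : Prop :=
  exists A, [/\ finite_set A, A `<=` M & P = conv A].

(* Vertices are the extreme points. *)
Definition vertices P : set V :=
  [set v | P v /\ forall (x y : V) (t : R), P x -> P y -> 0 < t < 1 ->
     v = t *: x + (1 - t) *: y -> x = v /\ y = v].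

Definition dilate k P : set V := [set k%:R *: x | x in P].

Definition lattice_points M P k : set V := dilate k P `&` M.

Definition minkowski A B : set V := [set x + y | x in A & y in B].

Definition translate v A : set V := [set u - v | u in A].

Definition nsum k A : set V :=
  [set x | exists2 w : 'I_k -> V,
     forall i, A (w i) & x = \sum_(i < k) w i].

Definition generated_monoid A : set V := \bigcup_k nsum k A.

Definition cone A : set V :=
  [set x | exists t : R, exists2 u, A u & 0 <= t /\ x = t *: u].

Definition very_ample M P : Prop :=
  forall v, vertices P v ->
    cone (translate v P) `&` M = generated_monoid (translate v (P `&` M)).

Definition k_normal M P k : Prop :=
  lattice_points M P k `<=` nsum k (P `&` M).

Definition normal_polytope M P : Prop :=
  forall k, (1 <= k)%N -> k_normal M P k.

Definition k_inv M P : nat :=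
  nat_min [set k | (0 < k)%N /\ forall j, (k <= j)%N -> k_normal M P j].

Definition d_inv M P : nat :=
  nat_min [set k | (0 < k)%N /\ forall j, (k <= j)%N ->
    lattice_points M P j.+1 = minkowski (P `&` M) (lattice_points M P j)].

Definition nu_inv M P : nat :=
  nat_min [set k | (0 < k)%N /\ forall j, (k <= j)%N ->
    lattice_points M P j.+1 = minkowski (vertices P) (lattice_points M P j)].

(* sigma M P d x v is $\sigma(x, dv)$. *)
Definition sigma M P d (x v : V) : nat :=
  nat_min [set m | exists2 w : 'I_m -> V, forall i, (P `&` M) (w i)
                   & x - d%:R *: v = \sum_(i < m) (w i - v)].

Definition m_inv M P : nat :=
  nat_max [set sigma M P (d_inv M P) x v
          | x in lattice_points M P (d_inv M P) & v in vertices P].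

End Polytopes.

(* Main.v *)
(* Dropping non-vertices from a generating set shows that P is the convex hull
   of its n vertices.  A point of (k+1)P with k+1 >= n is a combination of the
   vertices with total weight k+1, so some vertex has weight at least 1 and can
   be subtracted; hence d_P <= nu_P <= n-1.  Extremality of the vertices gives
   m_P >= sigma(d_P w, d_P v) >= d_P for vertices v <> w, and m_P = d_P makes P
   d_P-normal, which forces d_P = 1 and P normal.  If m_P > d_P, a lattice point
   of kP with k >= (m_P - d_P - 1) n + nu_P + 1 is the sum of a lattice point y of
   d_P P, nu_P - d_P points of P, and k - nu_P > (m_P - d_P - 1) n vertices; some
   vertex v occurs m_P - d_P times, and y + (m_P - d_P) v is a sum of m_P lattice
   points of P.  The resulting bound is smaller than (m_P - d_P) n + 1 because
   nu_P < n, so equality holds only for normal P. *)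
Require Import Defs.
From mathcomp Require Import all_boot all_order all_algebra.
From mathcomp Require Import mathcomp_extra boolp classical_sets functions.
From mathcomp Require Import cardinality reals.
From mathcomp Require Import ring lra zify.

Set Implicit Arguments.
Unset Strict Implicit.
Unset Printing Implicit Defensive.

Import Order.TTheory GRing.Theory Num.Theory.

Local Open Scope classical_set_scope.
Local Open Scope card_scope.
Local Open Scope ring_scope.

(** * Minima and maxima of sets of natural numbers *)

Lemma nat_minP (A : set nat) : A !=set0 -> A (nat_min A) /\ lbound A (nat_min A).
Proof.
move=> [a Aa]; apply: (@xgetPex _ 0%N (A `&` lbound A)).
have ex : exists k, `[< A k >] by exists a; apply/asboolP.
exists (ex_minn ex); case: ex_minnP => k /asboolP Ak kmin; split=> // j Aj.
exact/kmin/asboolP.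
Qed.

Lemma nat_maxP (A : set nat) (b : nat) : A !=set0 -> ubound A b ->
  A (nat_max A) /\ ubound A (nat_max A).
Proof.
move=> [a Aa] Ab; apply: (@xgetPex _ 0%N (A `&` ubound A)).
have ex : exists k, `[< A k >] by exists a; apply/asboolP.
have exb k : `[< A k >] -> (k <= b)%N by move=> /asboolP /Ab.
exists (ex_maxn ex exb); case: ex_maxnP => k /asboolP Ak kmax; split=> // j Aj.
exact/kmax/asboolP.
Qed.

Lemma finite_ubound (A : set nat) : finite_set A -> exists b, ubound A b.
Proof.
move=> /finite_seqP[s ->]; exists (\max_(i <- s) i) => i /= si.
exact: leq_bigmax_seq.
Qed.

Lemma big_uniq_eq (W : zmodType) (I : eqType) (r : seq I) (i : I) (F : I -> W) :
  uniq r -> i \in r -> \sum_(j <- r | i == j) F j = F i.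
Proof.
move=> ur ir; rewrite big_mkcond (bigD1_seq i)//= eqxx big1 ?addr0//.
by move=> j; rewrite eq_sym => /negPf ->.
Qed.

(** * Nonnegative combinations of prescribed total weight, and vertices of convex hulls *)

Section WeightedSums.
Variables (R : realType) (V : vectType R).
Implicit Types (S T : seq V) (c t : R) (x y v w : V).

(** For duplicate-free [S] and [0 < c] this is the dilate of the convex hull of [S] by [c]. A real
    total weight keeps the family closed under splitting off part of a generator, and weights
    defined on all of [V] can be added and scaled without reference to [S]. *)
Definition wcomb S c : set V :=
  [set x | exists a : V -> R, [/\ forall v, 0 <= a v,
     \sum_(v <- S) a v = c & x = \sum_(v <- S) a v *: v]].

Lemma wcomb_ge0 S c x : wcomb S c x -> 0 <= c.
Proof. by move=> [a [a0 <- _]]; apply: sumr_ge0. Qed.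

Lemma wcomb0 S x : wcomb S 0 x -> x = 0.
Proof.
move=> [a [a0 /eqP + ->]]; rewrite psumr_eq0// => /allP aS.
by rewrite big_seq big1// => v /aS /eqP ->; rewrite scale0r.
Qed.

Lemma wcombD S c1 c2 x y :
  wcomb S c1 x -> wcomb S c2 y -> wcomb S (c1 + c2) (x + y).
Proof.
move=> [a [a0 <- ->]] [b [b0 <- ->]]; exists (fun v => a v + b v); split.
- by move=> v; rewrite addr_ge0.
- by rewrite big_split.
- by rewrite -big_split; apply: eq_bigr => v _; rewrite scalerDl.
Qed.

Lemma wcombZ S c t x : 0 <= t -> wcomb S c x -> wcomb S (t * c) (t *: x).
Proof.
move=> t0 [a [a0 <- ->]]; exists (fun v => t * a v); split.
- by move=> v; rewrite mulr_ge0.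
- by rewrite mulr_sumr.
- by rewrite scaler_sumr; apply: eq_bigr => v _; rewrite scalerA.
Qed.

Lemma wcomb_perm S T c : perm_eq S T -> wcomb S c = wcomb T c.
Proof.
by move=> ST; apply/seteqP; split=> x [a [a0 <- ->]]; exists a;
  split=> //; apply: perm_big => //; rewrite perm_sym.
Qed.

(** Here [t] is the weight of [v]; since [v] is not in [S], that weight can be reset without
    disturbing the others. *)
Lemma wcomb_cons v S c x : v \notin S ->
  wcomb (v :: S) c x <-> exists2 t : R, 0 <= t & wcomb S (c - t) (x - t *: v).
Proof.
move=> vS; split.
- move=> [a [a0 <- ->]]; exists (a v) => //; exists a; split=> //.
  + by rewrite big_cons addrAC subrr add0r.
  + by rewrite big_cons addrAC subrr add0r.
- move=> [t t0 [a [a0 ca xa]]]; exists (fun u => if u == v then t else a u).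
  have S_neq u : u \in S -> (u == v) = false.
    by move=> uS; apply: contraNF vS => /eqP <-.
  split.
  + by move=> u; case: ifP.
  + rewrite big_cons eqxx (eq_big_seq a) ?ca ?subrKC//.
    by move=> u /S_neq ->.
  + rewrite big_cons eqxx (eq_big_seq (fun u => a u *: u)) -?xa ?subrKC//.
    by move=> u /S_neq ->.
Qed.

Lemma wcomb_mem S c v : uniq S -> v \in S -> 0 <= c -> wcomb S c (c *: v).
Proof.
move=> uS vS c0; rewrite (wcomb_perm _ (perm_to_rem vS)).
apply/wcomb_cons; first by rewrite mem_rem_uniqF.
exists c => //; rewrite !subrr; exists (fun=> 0); split=> //.
  by rewrite big1.
by rewrite big1// => u _; rewrite scale0r.
Qed.

Lemma wcomb_rem_sub S v c x :
  uniq S -> v \in S -> wcomb (rem v S) c x -> wcomb S c x.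
Proof.
move=> uS vS xS; rewrite (wcomb_perm _ (perm_to_rem vS)).
apply/wcomb_cons; first by rewrite mem_rem_uniqF.
by exists 0 => //; rewrite scale0r !subr0.
Qed.

(** If all weights were below 1, their total [c] would be less than [size S], unless [S] is empty,
    which [0 < c] excludes. A weight of at least 1 stays nonnegative after subtracting 1. *)
Lemma wcomb_ge1 S c x : uniq S -> 0 < c -> (size S)%:R <= c -> wcomb S c x ->
  exists2 v, v \in S & wcomb S (c - 1) (x - v).
Proof.
move=> uS c0 Sc [a [a0 ca xa]].
have [v vS av] : exists2 v, v \in S & 1 <= a v.
  apply: contrapT => nv.
  have a1 v : v \in S -> a v < 1.
    by move=> vS; rewrite ltNge; apply/negP => av; apply: nv; exists v.
  have : 0 <= \sum_(v <- S) (a v - 1).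
    by rewrite sumrB ca big_const_seq count_predT iter_addr_0 subr_ge0.
  have a1' v : v \in S -> 0 <= 1 - a v by move=> /a1; lra.
  have: 0 <= \sum_(v <- S) (1 - a v) by rewrite big_seq sumr_ge0.
  move=> s1 s2; have /eqP : \sum_(v <- S | v \in S) (1 - a v) = 0.
    rewrite -big_seq; apply/le_anti; rewrite s1 andbT -oppr_ge0 -sumrN.
    by under eq_bigr do rewrite opprB.
  rewrite psumr_eq0// => /allP aS.
  case: S {uS Sc xa nv s1 s2 a1'} ca a1 aS => [|v S] ca a1 aS.
    by move: ca c0; rewrite big_nil => <-; rewrite ltxx.
  have := aS v (mem_head _ _); rewrite mem_head => /eqP.
  by have := a1 v (mem_head _ _); lra.
exists v => //; have /wcomb_cons : v \notin rem v S by rewrite mem_rem_uniqF.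
rewrite (wcomb_perm _ (perm_to_rem vS)) => E; apply/E.
exists (a v - 1); first by rewrite subr_ge0.
exists a; split=> //.
  by rewrite -ca (perm_big _ (perm_to_rem vS)) /= big_cons; ring.
rewrite xa (perm_big _ (perm_to_rem vS)) /= big_cons scalerBl scale1r.
by rewrite -addrA -opprD subrKC addrAC subrr add0r.
Qed.

Lemma conv_wcomb S : uniq S -> conv [set` S] = wcomb S 1.
Proof.
move=> uS; apply/seteqP; split=> x.
- move=> [m [s [a [sS a0 a1 ->]]]].
  (* The points [s i] may repeat, so the weight of [v] collects all indices mapped to it. *)
  exists (fun v => \sum_(i < m | s i == v) a i); split.
  + by move=> v; apply: sumr_ge0.
  + rewrite -a1 (exchange_big_dep xpredT)//=; apply: eq_bigr => i _.
    by rewrite big_uniq_eq// sS.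
  + under [RHS]eq_bigr do rewrite scaler_suml.
    rewrite (exchange_big_dep xpredT)//=; apply: eq_bigr => i _.
    by rewrite big_uniq_eq// sS.
- move=> [a [a0 a1 ->]].
  exists (size S), (fun i => S`_i), (fun i => a S`_i); split=> //.
  + by move=> i /=; rewrite mem_nth.
  + by rewrite -a1 [RHS](big_nth 0) big_mkord.
  + by rewrite [LHS](big_nth 0) big_mkord.
Qed.

Lemma dilate_wcomb S k : (0 < k)%N -> dilate k (wcomb S 1) = wcomb S k%:R.
Proof.
move=> k0; have kR : k%:R != 0 :> R by rewrite pnatr_eq0 -lt0n.
apply/seteqP; split=> x.
- by move=> [y Py <-]; rewrite -[X in wcomb S X](mulr1 k%:R); apply: wcombZ.
- move=> xk; exists (k%:R^-1 *: x); last by rewrite scalerA divff// scale1r.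
  by rewrite -[X in wcomb S X](mulVf kR); apply: wcombZ; rewrite ?invr_ge0.
Qed.

(** Some generator [w] has positive weight in [x]. If that weight is 1 then [x = w]; otherwise [x]
    lies strictly between [w] and the normalized rest, and extremality gives [x = w]. *)
Lemma vertices_wcomb_sub S :
  uniq S -> vertices (wcomb S 1) `<=` [set` S].
Proof.
move=> uS x [[a [a0 a1 xa]] xext] /=.
have [w wS aw] : exists2 w, w \in S & 0 < a w.
  apply: contrapT => nw; have : (1 : R) == 0.
    rewrite -a1 big_seq big1// => v vS; apply/eqP.
    by rewrite eq_le a0 andbT leNgt; apply/negP => av; apply: nw; exists v.
  by rewrite oner_eq0.
have xw : wcomb (rem w S) (1 - a w) (x - a w *: w).
  exists a; split=> //.
    by rewrite -a1 (perm_big _ (perm_to_rem wS)) /= big_cons addrAC subrr add0r.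
  by rewrite xa (perm_big _ (perm_to_rem wS)) /= big_cons addrAC subrr add0r.
have := wcomb_ge0 xw; rewrite subr_ge0 le_eqVlt => /orP[/eqP aw1|aw1].
  move: xw; rewrite aw1 subrr => /wcomb0 /eqP.
  by rewrite scale1r subr_eq0 => /eqP ->.
have aw1' : 1 - a w != 0 by lra.
have [||||<- _//] := xext w ((1 - a w)^-1 *: (x - a w *: w)) (a w).
- by rewrite -(scale1r w); apply: wcomb_mem.
- apply: (wcomb_rem_sub uS wS).
  rewrite -[X in wcomb _ X](mulVf aw1'); apply: wcombZ => //.
  by rewrite invr_ge0; lra.
- by rewrite aw.
- by rewrite scalerA divff// scale1r subrKC.
Qed.

(** By contraposition: a generator outside the hull of the others is extreme. Inside that hull, its
    weight can be redistributed over the others. *)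
Lemma wcomb_rem S v : uniq S -> v \in S -> ~ vertices (wcomb S 1) v ->
  wcomb (rem v S) 1 = wcomb S 1.
Proof.
move=> uS vS nv; have vS' : v \notin rem v S by rewrite mem_rem_uniqF.
have pS := perm_to_rem vS.
suff vT : wcomb (rem v S) 1 v.
  apply/seteqP; split=> x; first exact: wcomb_rem_sub.
  rewrite (wcomb_perm _ pS) => /(wcomb_cons _ _ vS')[t t0 xt].
  by rewrite -(subrK t 1) -(subrK (t *: v) x) -{2}(mulr1 t);
    apply: wcombD => //; apply: wcombZ.
apply: contrapT => nvT; apply: nv; split.
  by rewrite -(scale1r v); apply: wcomb_mem.
move=> x y t; rewrite (wcomb_perm _ pS).
move=> /(wcomb_cons _ _ vS')[a a0 xa] /(wcomb_cons _ _ vS')[b b0 yb].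
move=> /andP[t0 t1] vE.
have a1 := wcomb_ge0 xa; have b1 := wcomb_ge0 yb.
(* This is the weight of [v] in its own expression. Below 1, solving for [v] puts it in the hull of
   the others; otherwise [a = b = 1], so both endpoints equal [v]. *)
have [c1|c1] := ltP (t * a + (1 - t) * b) 1.
  exfalso; apply: nvT; set c := t * a + (1 - t) * b in c1.
  have c1' : 1 - c != 0 by lra.
  have vE' : v = (1 - c)^-1 *: (t *: (x - a *: v) + (1 - t) *: (y - b *: v)).
    apply: (scalerI c1'); rewrite scalerA divff// scale1r.
    rewrite !scalerBr addrACA -vE -opprD !scalerA -scalerDl -/c.
    by rewrite scalerBl scale1r.
  rewrite [X in wcomb _ _ X]vE' -[X in wcomb _ X](mulVf c1').
  apply: wcombZ; first by rewrite invr_ge0; lra.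
  have -> : 1 - c = t * (1 - a) + (1 - t) * (1 - b) by rewrite /c; ring.
  by apply: wcombD; apply: wcombZ => //; lra.
have [a1' b1'] : a = 1 /\ b = 1.
  have ta : 0 <= t * (1 - a) by rewrite mulr_ge0// ltW.
  have tb : 0 <= (1 - t) * (1 - b) by rewrite mulr_ge0// subr_ge0 ltW.
  have /eqP : t * (1 - a) = 0 by lra.
  have /eqP : (1 - t) * (1 - b) = 0 by lra.
  by rewrite !mulf_eq0 => /orP[] /eqP ? /orP[] /eqP ?; lra.
move: xa yb; rewrite a1' b1' subrr scale1r => /wcomb0 /eqP + /wcomb0 /eqP.
by rewrite !subr_eq0 => /eqP -> /eqP ->.
Qed.

(** Non-vertices are removed one at a time, by induction on the size; each removal leaves the hull
    unchanged. *)
Lemma wcomb_vertices S : uniq S -> exists T,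
  [/\ uniq T, {subset T <= S}, wcomb T 1 = wcomb S 1 & vertices (wcomb T 1) = [set` T]].
Proof.
have [k] := ubnP (size S); elim: k S => // k IH S Sk uS.
have [all_vert|] := pselect ([set` S] `<=` vertices (wcomb S 1)).
  exists S; split=> //; apply/seteqP; split=> //; exact: vertices_wcomb_sub.
move=> /existsNP[v /not_implyP[/= vS nv]].
have [||T [uT TS ET VT]] := IH (rem v S).
- by rewrite size_rem// -ltnS prednK//; case: (S) vS Sk => //= ? ? _; lia.
- exact: rem_uniq.
exists T; split=> //.
- by move=> u /TS /mem_rem.
- by rewrite ET wcomb_rem.
Qed.

Lemma conv_vertices (A : set V) : finite_set A -> exists S,
  [/\ uniq S, [set` S] `<=` A, conv A = wcomb S 1 & vertices (conv A) = [set` S]].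
Proof.
move=> /finite_seqP[s ->].
have -> : [set` s] = [set` undup s].
  by apply/seteqP; split=> x /=; rewrite mem_undup.
rewrite conv_wcomb ?undup_uniq//.
have [T [uT Ts <- vT]] := wcomb_vertices (undup_uniq s).
by exists T; split.
Qed.

End WeightedSums.

(** * Sums of a fixed number of points of a set *)

Lemma perm_nseq_cat (T : eqType) (v : T) c (s : seq T) : (c <= count_mem v s)%N ->
  exists t, perm_eq s (nseq c v ++ t).
Proof.
elim: c s => [|c IH] s cs; first by exists s.
have vs : v \in s by rewrite -has_pred1 has_count (leq_ltn_trans _ cs).
have [|t st] := IH (rem v s).
  by move: cs; rewrite (permP (perm_to_rem vs)) /= eqxx.
by exists t; rewrite (perm_trans (perm_to_rem vs))//= perm_cons.
Qed.

Section Sums.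
Variables (R : realType) (V : vectType R).
Implicit Types (A B : set V) (x y v w : V).

Lemma nsumP k A x : nsum k A x <-> exists s : seq V,
  [/\ size s = k, forall y, y \in s -> A y & x = \sum_(y <- s) y].
Proof.
split=> [[w Aw ->]|[s [<- As ->]]].
  exists [seq w i | i <- enum 'I_k]; split.
  - by rewrite size_map size_enum_ord.
  - by move=> y /mapP[i _ ->].
  - by rewrite big_map big_enum.
exists (fun i => s`_i); first by move=> i; apply/As/mem_nth.
by rewrite (big_nth 0) big_mkord.
Qed.

Lemma nsumS A B k x : A `<=` B -> nsum k A x -> nsum k B x.
Proof. by move=> AB [w Aw ->]; exists w => // i; apply/AB. Qed.

Lemma nsum0 A : nsum 0 A 0.
Proof. by apply/nsumP; exists [::]; split=> //; rewrite big_nil. Qed.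

Lemma nsum_eq0 A x : nsum 0 A x -> x = 0.
Proof. by move=> /nsumP[s [/size0nil -> _ ->]]; rewrite big_nil. Qed.

Lemma nsumD A j k x y : nsum j A x -> nsum k A y -> nsum (j + k) A (x + y).
Proof.
move=> /nsumP[s [<- As ->]] /nsumP[t [<- At ->]]; apply/nsumP.
exists (s ++ t); split; rewrite ?size_cat ?big_cat// => z.
by rewrite mem_cat => /orP[/As|/At].
Qed.

Lemma nsum_const A k v : A v -> nsum k A (k%:R *: v).
Proof.
move=> Av; exists (fun=> v) => //.
by rewrite sumr_const card_ord scaler_nat.
Qed.

Lemma nsum1 A v : A v -> nsum 1 A v.
Proof. by move=> Av; rewrite -[v]scale1r; apply: nsum_const. Qed.

Lemma nsumSE k A x : nsum k.+1 A x -> exists2 y, A y & nsum k A (x - y).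
Proof.
move=> /nsumP[[|y s] [//= [sk] As ->]]; exists y; first exact/As/mem_head.
apply/nsumP; exists s; split=> //; first by move=> z zs; apply: As; rewrite inE zs orbT.
by rewrite big_cons addrAC subrr add0r.
Qed.

(** Adding back the [k] shifts by [v] turns the condition defining [sigma] into one on untranslated
    sums, to which [nsumD] applies. *)
Lemma nsum_translate k A v x :
  (exists2 w : 'I_k -> V, forall i, A (w i) & x = \sum_(i < k) (w i - v)) <->
  nsum k A (x + k%:R *: v).
Proof.
split=> -[w Aw xE]; exists w => //.
  by rewrite xE sumrB sumr_const card_ord scaler_nat subrK.
by rewrite sumrB sumr_const card_ord -scaler_nat -xE addrK.
Qed.

Lemma generated_translate A v x :
  generated_monoid (translate v A) x <-> exists k, nsum k A (x + k%:R *: v).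
Proof.
split=> [[k _ [w Aw ->]]|[k /nsum_translate[w Aw ->]]]; exists k.
- apply/nsum_translate; have /choice[u uP] i : exists u, A u /\ u - v = w i.
    by have [u ? ?] := Aw i; exists u.
  by exists u => [i|]; [case: (uP i)|apply: eq_bigr => i _; case: (uP i)].
- by [].
- by exists (fun i => w i - v) => // i; exists (w i).
Qed.

Lemma nsum_pigeonhole k c (S : seq V) x : nsum k [set` S] x -> (c * size S < k)%N ->
  exists2 v, v \in S & nsum (k - c.+1) [set` S] (x - c.+1%:R *: v).
Proof.
move=> /nsumP[s [<- sS ->]] cS.
have [v vS cv] : exists2 v, v \in S & (c < count_mem v s)%N.
  apply: contrapT => nv; move: cS; rewrite ltnNge => /negP; apply.
  (* Double counting: exchanging the sums turns the right side into the total of the multiplicities,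
     each at most [c] by assumption. *)
  have sc : (\sum_(y <- s) 1 <= \sum_(y <- s) \sum_(v <- S) (y == v))%N.
    rewrite big_seq [leqRHS]big_seq leq_sum// => y /sS /= yS.
    by rewrite (big_rem y)//= eqxx.
  rewrite -sum1_size (leq_trans sc)// exchange_big/=.
  have -> : (c * size S = \sum_(v <- S) c)%N.
    by rewrite big_const_seq count_predT iter_addn_0.
  rewrite big_seq [leqRHS]big_seq leq_sum// => v vS.
  rewrite leqNgt; apply/negP => cv; apply: nv; exists v => //.
  by rewrite -sum1_count [X in (_ < X)%N]big_mkcond.
exists v => //; have [t st] := perm_nseq_cat cv.
apply/nsumP; exists t; split.
- by rewrite (perm_size st) size_cat size_nseq addKn.
- by move=> y yt; apply: sS; rewrite (perm_mem st) mem_cat yt orbT.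
- rewrite (perm_big _ st) big_cat big_nseq iter_addr_0.
  by rewrite -scaler_nat addrAC subrr add0r.
Qed.

(** Peels off one summand from [B] per level; used with the vertices from level [nu] and with [P]
    cut by [M] from level [d]. *)
Lemma lattice_points_split M P B K j x :
  (forall i, (K <= i)%N ->
     lattice_points M P i.+1 `<=` minkowski B (lattice_points M P i)) ->
  lattice_points M P (K + j) x ->
  exists2 y, lattice_points M P K y & nsum j B (x - y).
Proof.
move=> KB; elim: j x => [|j IH] x.
  by rewrite addn0 => xK; exists x => //; rewrite subrr; apply: nsum0.
rewrite addnS => /KB -/(_ (leq_addr _ _))[b Bb [z /IH[y yK zy] <-]].
by exists y => //; rewrite -addrA -add1n; apply: nsumD => //; apply: nsum1.
Qed.

End Sums.

(** * Lattice operations and finiteness of lattice points *)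

Section Lattice.
Variables (R : realType) (V : vectType R).
Implicit Types (M : set V) (S : seq V) (x y : V).

Lemma lattice0 M : is_lattice M -> M 0.
Proof.
move=> [e _ ->]; exists [ffun=> 0]; rewrite big1// => i _.
by rewrite ffunE mulr0z.
Qed.

Lemma latticeB M x y : is_lattice M -> M x -> M y -> M (x - y).
Proof.
move=> [e _ ->] [a ->] [b ->]; exists [ffun i => a i - b i].
by rewrite -sumrB; apply: eq_bigr => i _; rewrite ffunE mulrzBr.
Qed.

Lemma latticeD M x y : is_lattice M -> M x -> M y -> M (x + y).
Proof.
move=> hM Mx My; rewrite -[y]opprK -[- y]add0r.
by apply: latticeB => //; apply: latticeB => //; apply: lattice0.
Qed.

Lemma lattice_nsum M k x : is_lattice M -> nsum k M x -> M x.
Proof.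
move=> hM; elim: k x => [|k IH] x; first by move=> /nsum_eq0 ->; apply: lattice0.
by move=> /nsumSE[y My /IH /(latticeD hM My)]; rewrite subrKC.
Qed.

Lemma finite_lattice_wcomb M S c : is_lattice M -> finite_set (wcomb S c `&` M).
Proof.
move=> [e be ->].
(* Each weight is at most [c], so [B] bounds every coordinate at once. Shifted by [N], the integer
   coordinates lie between 0 and [N + N], leaving finitely many choices. *)
pose B := \sum_(v <- S) \sum_i c * `|coord e i v|.
pose N := Num.bound B.
pose f (g : {ffun 'I_(\dim {:V}) -> 'I_(N + N).+1}) : V :=
  \sum_(i < \dim {:V}) e`_i *~ ((g i)%:Z - N%:Z).
apply: (@sub_finite_set _ _ (f @` setT)); last exact/finite_image/finite_finset.
move=> x [[a [a0 ac xa]] [z xz]].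
have coordx i : coord e i x = (z i)%:~R.
  rewrite xz; under eq_bigr do rewrite -scaler_int.
  by rewrite coord_sum_free// (basis_free be).
have c0 : 0 <= c by rewrite -ac sumr_ge0.
have zB i : `|(z i)%:~R| <= B :> R.
  rewrite -coordx xa linear_sum (le_trans (ler_norm_sum _ _ _))//.
  rewrite /B big_seq [leRHS]big_seq ler_sum// => v vS.
  rewrite linearZ/= normrM ger0_norm// (bigD1 i)//= ler_wpDr//.
    by apply: sumr_ge0 => j _; rewrite mulr_ge0.
  by rewrite ler_wpM2r// -ac (big_rem v)//= lerDl sumr_ge0.
have zN i : `|z i| < N%:Z.
  rewrite -(ltr_int R) -pmulrn intr_norm (le_lt_trans (zB i))//.
  by rewrite archi_boundP// (le_trans _ (zB i)).
exists [ffun i => inord (absz (z i + N%:Z))] => //.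
rewrite xz; apply: eq_bigr => i _; congr (_ *~ _).
by rewrite ffunE inordK; have := zN i; lia.
Qed.

End Lattice.

(** * The invariants of a very ample polytope whose vertices are listed by [S] *)

Section VeryAmple.
Variables (R : realType) (V : vectType R) (M P : set V) (S : seq V).
Hypothesis hM : is_lattice M.
Hypothesis uS : uniq S.
Hypothesis SM : [set` S] `<=` M.
Hypothesis PE : P = wcomb S 1.
Hypothesis vertS : vertices P = [set` S].
Hypothesis S_gt1 : (1 < size S)%N.
Hypothesis va : very_ample M P.

Local Notation d := (d_inv M P).
Local Notation nu := (nu_inv M P).
Local Notation m := (m_inv M P).
Local Notation L := (lattice_points M P).

Lemma lattice_pointsE k : (0 < k)%N -> L k = wcomb S k%:R `&` M.
Proof. by move=> k0; rewrite /lattice_points PE dilate_wcomb. Qed.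

Lemma lattice_points1 : L 1 = P `&` M.
Proof. by rewrite lattice_pointsE// PE. Qed.

Lemma vertex_exists : exists v, v \in S.
Proof. by case: (S) S_gt1 => // v s _; exists v; rewrite mem_head. Qed.

Lemma vertex_lattice_point v : v \in S -> (P `&` M) v.
Proof.
move=> vS; split; last exact: SM.
by rewrite PE -(scale1r v); apply: wcomb_mem.
Qed.

Lemma lattice_pointsD k : (0 < k)%N -> minkowski (P `&` M) (L k) `<=` L k.+1.
Proof.
move=> k0 z; rewrite [L k.+1]lattice_pointsE// => -[x [Px Mx] [y + <-]].
rewrite lattice_pointsE// => -[ky My]; split.
  by rewrite -nat1r; apply: wcombD => //; rewrite -PE.
exact: latticeD.
Qed.

Lemma nsum_lattice_points k x : (0 < k)%N -> nsum k (P `&` M) x -> L k x.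
Proof.
case: k => // k _; elim: k x => [|k IH] x /nsumSE[y Py].
  by move=> /nsum_eq0 /eqP; rewrite subr_eq0 => /eqP ->; rewrite lattice_points1.
move=> /IH xy; apply: lattice_pointsD => //.
by exists y => //; exists (x - y) => //; rewrite subrKC.
Qed.

Lemma lattice_pointsS_vertex k : (0 < k)%N -> (size S <= k.+1)%N ->
  L k.+1 `<=` minkowski (vertices P) (L k).
Proof.
move=> k0 Sk x; rewrite !lattice_pointsE// => -[xk Mx].
have [||v vS xv] := wcomb_ge1 uS _ _ xk; [by rewrite ltr0n|by rewrite ler_nat|].
exists v; first by rewrite vertS.
exists (x - v); last by rewrite subrKC.
split; last by apply: latticeB => //; apply: SM.
by move: xv; rewrite -natr1 addrK.
Qed.

Lemma nu_invP : [/\ (0 < nu)%N, (nu < size S)%N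
  & forall j, (nu <= j)%N -> L j.+1 = minkowski (vertices P) (L j)].
Proof.
set A := [set k | (0 < k)%N /\ forall j, (k <= j)%N ->
  L j.+1 = minkowski (vertices P) (L j)].
(* This member makes [nu] a true minimum rather than the default 0, and gives the upper bound. *)
have Sn : A (size S).-1.
  split=> [|j Sj]; first by lia.
  apply/seteqP; split; first by apply: lattice_pointsS_vertex; lia.
  move=> x [v]; rewrite vertS => vS [y Ly <-]; apply: lattice_pointsD; first by lia.
  by exists v; [exact: vertex_lattice_point|exists y].
have [[? ?] nu_min] := nat_minP (ex_intro _ _ Sn); split=> //.
by have := nu_min _ Sn; rewrite -/nu; case: (S) S_gt1.
Qed.

Lemma d_invP : [/\ (0 < d)%N, (d <= nu)%N,
  forall j, (d <= j)%N -> L j.+1 = minkowski (P `&` M) (L j)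
  & k_normal M P d -> d = 1%N].
Proof.
set A := [set k | (0 < k)%N /\ forall j, (k <= j)%N ->
  L j.+1 = minkowski (P `&` M) (L j)].
have [nu0 _ nuP] := nu_invP.
have Anu : A nu.
  split=> // j nuj; apply/seteqP; split; last by apply: lattice_pointsD; lia.
  rewrite nuP// => x [v]; rewrite vertS => vS [y Ly <-].
  by exists v; [exact: vertex_lattice_point|exists y].
have [[d0 dP] d_min] := nat_minP (ex_intro _ _ Anu); rewrite -/d in d0 dP d_min.
split=> //; first exact: d_min.
move=> normd; apply/eqP; rewrite eqn_leq d0 andbT leqNgt; apply/negP => d1.
(* With [1 < d], splitting one summand off a sum of [d] points also settles the passage from level
   [d.-1] to [d], against minimality. *)
suff /d_min : A d.-1 by rewrite /=; lia.
split=> [|j]; first by lia.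
rewrite leq_eqVlt => /orP[/eqP <-|]; last by rewrite prednK// => /dP.
apply/seteqP; split; last by apply: lattice_pointsD; lia.
rewrite prednK// => x /normd; rewrite -{1}(prednK d0) => /nsumSE[y Py xy].
exists y => //; exists (x - y); last by rewrite subrKC.
by apply: nsum_lattice_points xy; lia.
Qed.

(** Since [x - d v = d (y - v)] for some [y] in [P], this vector lies in the cone at [v]; very
    ampleness then makes the set defining [sigma] nonempty. *)
Lemma sigmaP x v : L d x -> v \in S ->
  nsum (sigma M P d x v) (P `&` M) (x - d%:R *: v + (sigma M P d x v)%:R *: v)
  /\ forall k, nsum k (P `&` M) (x - d%:R *: v + k%:R *: v) ->
       (sigma M P d x v <= k)%N.
Proof.
move=> Lx vS; have [d0 _ _ _] := d_invP.
set A := [set k | exists2 w : 'I_k -> V, forall i, (P `&` M) (w i)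
                   & x - d%:R *: v = \sum_(i < k) (w i - v)].
have [|/nsum_translate ? sm] := @nat_minP A; last first.
  by split=> // k /nsum_translate; apply: sm.
suff /generated_translate[k /nsum_translate] :
  generated_monoid (translate v (P `&` M)) (x - d%:R *: v) by exists k.
rewrite -va ?vertS//; case: Lx => -[y Py <-] Mx; split.
  exists d%:R; exists (y - v); first by exists y.
  by rewrite ler0n scalerBr.
apply: latticeB => //; apply: lattice_nsum hM _.
by apply: (nsum_const d); apply: SM.
Qed.

Lemma m_invP :
  (exists x v, [/\ L d x, v \in S & m = sigma M P d x v]) /\
  forall x v, L d x -> v \in S -> (sigma M P d x v <= m)%N.
Proof.
have [d0 _ _ _] := d_invP.
set A := [set sigma M P d x v | x in L d & v in vertices P].
(* Finiteness, with [A0] below, ensures that [m] is an attained maximum and not the default 0. *)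
have finA : finite_set A.
  apply: finite_image2; last by rewrite vertS.
  by rewrite lattice_pointsE//; apply: finite_lattice_wcomb.
have [b Ab] := finite_ubound finA.
have [v vS] := vertex_exists.
have A0 : A !=set0.
  exists (sigma M P d (d%:R *: v) v); exists (d%:R *: v).
    by apply: nsum_lattice_points => //; apply: nsum_const; apply: vertex_lattice_point.
  by exists v => //; rewrite vertS.
have [[x Lx [w]]] := nat_maxP A0 Ab; rewrite vertS => wS mE mP; split.
  by exists x, w; split.
by move=> y u Ly uS'; apply: mP; exists y => //; exists u => //; rewrite vertS.
Qed.

(** Dividing by [k.+1] writes [w] as a convex combination of [v] and, for positive [k], a point of
    [P]; extremality of [w] concludes. *)
Lemma vertex_summand k v w : w \in S -> P v ->
  wcomb S k%:R (k.+1%:R *: w - v) -> v = w.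
Proof.
move=> wS Pv.
case: k => [|k] kw; first by move/wcomb0/eqP: kw; rewrite scale1r subr_eq0 => /eqP.
have [_ wext] : vertices P w by rewrite vertS.
have k1 : k.+1%:R != 0 :> R by rewrite pnatr_eq0.
have k2 : k.+2%:R != 0 :> R by rewrite pnatr_eq0.
have [||||-> _] // := wext v (k.+1%:R^-1 *: (k.+2%:R *: w - v)) k.+2%:R^-1.
- rewrite PE -[X in wcomb _ X](mulVf k1); apply: wcombZ => //.
  by rewrite invr_ge0.
- by rewrite invr_gt0 ltr0n invf_lt1 ?ltr0n// ltr1n.
- apply: (scalerI k2); rewrite scalerDr !scalerA divff// scale1r.
  have -> : k.+2%:R * (1 - k.+2%:R^-1) / k.+1%:R = 1 :> R.
    by rewrite mulrBr mulr1 divff// -natr1 addrK divff.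
  by rewrite scale1r subrKC.
Qed.

Lemma d_le_m : (d <= m)%N.
Proof.
have [d0 _ _ _] := d_invP; have [_ mP] := m_invP.
have [v [w [vS wS vw]]] : exists v w, [/\ v \in S, w \in S & v != w].
  case: (S) uS S_gt1 => [|v [|w s]]//= /andP[vs _] _.
  exists v, w; rewrite !inE !eqxx orbT; split=> //.
  by apply: contraNneq vs => ->; rewrite mem_head.
have Ldw : L d (d%:R *: w).
  by apply: nsum_lattice_points => //; apply: nsum_const; apply: vertex_lattice_point.
apply: leq_trans (mP _ _ Ldw vS); have [+ _] := sigmaP Ldw vS.
set k := sigma _ _ _ _ _ => kP; rewrite leqNgt; apply/negP => kd.
move/negP: vw; apply; apply/eqP.
apply: (@vertex_summand d.-1) => //; first by case: (vertex_lattice_point vS).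
rewrite prednK//.
have [Pv Mv] := vertex_lattice_point vS.
(* If [sigma] were some [k < d], padding its [k] summands with [d.-1 - k] copies of [v] would give
   this sum, whence [v = w]. *)
have dk1 : nsum d.-1 (P `&` M) (d%:R *: w - v).
  have -> : d.-1 = (k + (d.-1 - k))%N by lia.
  have -> : d%:R *: w - v
      = d%:R *: w - d%:R *: v + k%:R *: v + (d.-1 - k)%:R *: v.
    rewrite -!addrA -scalerDl -natrD; congr (_ + _).
    have -> : (k + (d.-1 - k) = d.-1)%N by lia.
    by rewrite -{1}(prednK d0) -natr1 scalerDl scale1r opprD addrAC addNr add0r.
  by apply: nsumD => //; apply: nsum_const.
case: (posnP d.-1) dk1 => [-> /nsum_eq0 ->|d1 /(nsum_lattice_points d1)].
  by exists (fun=> 0); split=> //; rewrite big1// => u _; rewrite scale0r.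
by rewrite lattice_pointsE// => -[].
Qed.

(** A shortest expression has at most [m] summands and is padded with copies of [v]; by [d_le_m] the
    subtraction [m - d] is not truncated. *)
Lemma nsum_m x v : L d x -> v \in S ->
  nsum m (P `&` M) (x + (m - d)%:R *: v).
Proof.
move=> Lx vS; have [_ /(_ _ _ Lx vS) sm] := m_invP.
have [+ _] := sigmaP Lx vS; set k := sigma _ _ _ _ _ in sm * => kx.
rewrite -[X in nsum X](subnKC sm).
have -> : x + (m - d)%:R *: v = x - d%:R *: v + k%:R *: v + (m - k)%:R *: v.
  rewrite -!addrA; congr (_ + _); rewrite -scalerDl -natrD subnKC//.
  by rewrite -scaleNr -scalerDl natrB ?d_le_m// addrC.
by apply: nsumD => //; apply: nsum_const; apply: vertex_lattice_point.
Qed.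

Lemma m_eq_d_normal : m = d -> normal_polytope M P.
Proof.
have [d0 _ dP dnorm] := d_invP => md.
have [v vS] := vertex_exists.
have norm_d : k_normal M P d.
  by move=> x /nsum_m /(_ vS); rewrite md subnn scale0r addr0.
have d1 := dnorm norm_d => k k0 x Lx.
have [||y Ly xy] := @lattice_points_split _ _ M P (P `&` M) 1 k.-1 x.
- by move=> i i1; rewrite dP// d1.
- by rewrite add1n prednK.
rewrite -(prednK k0) -add1n -(subrKC y x); apply: nsumD => //.
by apply: nsum1; rewrite -lattice_points1.
Qed.

Lemma normal_k_d_m : normal_polytope M P -> [/\ k_inv M P = 1%N, d = 1%N & m = 1%N].
Proof.
move=> nP; have [d0 _ _ dnorm] := d_invP.
have d1 : d = 1%N by apply: dnorm; apply: nP.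
have [[x [v [Lx vS mE]]] _] := m_invP.
have A1 : [set k | (0 < k)%N /\ forall j, (k <= j)%N -> k_normal M P j] 1%N.
  by split=> // j /nP.
have [[k0 _] kmin] := nat_minP (ex_intro _ _ A1).
split=> //.
  by apply/eqP; rewrite eqn_leq k0 andbT; apply: kmin.
(* The lower bound is [d_le_m]; for the upper one, [d = 1] makes [x] itself a point of [P] in [M],
   so one summand suffices. *)
apply/eqP; rewrite eqn_leq -{2}d1 d_le_m andbT mE.
have [_] := sigmaP Lx vS; apply.
rewrite d1 !scale1r subrK; apply: nsum1; rewrite -lattice_points1.
by rewrite -[X in L X]d1.
Qed.

Lemma k_inv_le : ~ normal_polytope M P ->
  (d < m)%N /\ (k_inv M P <= (m - d).-1 * size S + nu + 1)%N.
Proof.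
move=> nnP; have dm : (d < m)%N.
  rewrite ltn_neqAle d_le_m andbT; apply/eqP => dm; apply: nnP.
  exact/m_eq_d_normal.
split=> //; have [nu0 _ nuP] := nu_invP; have [d0 dnu dP _] := d_invP.
set c := ((m - d).-1 * size S)%N; set K := (c + nu + 1)%N.
(* Guarantees [m - d <= j - nu] below, so that the decomposition of [j] involves no truncated
   subtraction. *)
have dmc : ((m - d).-1 <= c)%N by apply: leq_pmulr; apply: ltnW.
have AK : [set k | (0 < k)%N /\ forall j, (k <= j)%N -> k_normal M P j] K.
  split=> [|j Kj x Lx]; first by rewrite /K addn1.
  have [||y Ly xy] := @lattice_points_split _ _ M P (vertices P) nu (j - nu) x.
  - by move=> i /nuP ->.
  - by rewrite subnKC//; move: Kj; rewrite /K; lia.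
  have [||z Lz yz] := @lattice_points_split _ _ M P (P `&` M) d (nu - d) y.
  - by move=> i /dP ->.
  - by rewrite subnKC.
  rewrite vertS in xy.
  have [|v vS xyv] := nsum_pigeonhole xy (_ : (c < _)%N).
    by move: Kj; rewrite /K; lia.
  rewrite prednK ?subn_gt0// in xyv.
  have -> : j = (m + (nu - d) + (j - nu - (m - d)))%N.
    by move: Kj dm dnu dmc; rewrite /K; lia.
  (* The three groups are sums of [m], [nu - d] and [j - nu - (m - d)] lattice points of [P]. *)
  have -> : x = z + (m - d)%:R *: v + (y - z) + (x - y - (m - d)%:R *: v).
    by rewrite [z + _ + _]addrAC subrKC -[x - y - _]addrA -opprD subrKC.
  apply: nsumD; first by apply: nsumD => //; apply: nsum_m.
  by apply: nsumS xyv => u; apply: vertex_lattice_point.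
by have [_ kmin] := nat_minP (ex_intro _ _ AK); apply: kmin.
Qed.

End VeryAmple.

(** Integers keep [m - d] exact. A single lattice point has [m = 0] and [d = k = 1], so the first
    bound would read [1 <= 0]; hence [1 < n]. *)
Theorem theorem2p7 (R : realType) (V : vectType R) (M P : set V) (n : nat)
    (hM : is_lattice M) (hP : is_lattice_polytope M P)
    (hva : very_ample M P)
    (hn : vertices P #= `I_n) (hn1 : (1 < n)%N) :
  let k : int := (k_inv M P)%:Z in
  let d : int := (d_inv M P)%:Z in
  let nu : int := (nu_inv M P)%:Z in
  let m : int := (m_inv M P)%:Z in
  [/\ k <= (m - d) * n%:Z + 1,
      k = (m - d) * n%:Z + 1 <-> normal_polytope M P
    & ~ normal_polytope M P -> k <= (m - d - 1) * n%:Z + nu + 1].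
Proof.
move=> k d nu m; have [A [finA AM PA]] := hP.
have [S [uS SA PE vertS]] := conv_vertices finA; rewrite -PA in PE vertS.
have SM := subset_trans SA AM.
have nS : n = size S.
  rewrite -(card_fset_set hn) vertS; apply/perm_size/uniq_perm => // x.
  rewrite in_fset_set; first by apply/idP/idP => [/set_mem|/mem_set].
  by apply/finite_seqP; exists S.
rewrite nS in hn1 *.
have [nP|nnP] := pselect (normal_polytope M P).
  have [k1 d1 m1] := normal_k_d_m hM uS SM PE vertS hn1 hva nP.
  by rewrite /k /m /d k1 d1 m1 subrr mul0r add0r; split.
have [dm] := k_inv_le hM uS SM PE vertS hn1 hva nnP.
have [_ nun _] := nu_invP hM uS SM PE vertS hn1.
have -> : m - d = (m_inv M P - d_inv M P).-1%:Z + 1 by rewrite /m /d; lia.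
rewrite addrK mulrDl -PoszM mul1r /k /nu.
(* As [nu < size S], the bound [c + nu + 1] is strictly below [c + size S + 1], which yields the
   first inequality and excludes equality. *)
move: (_ * _)%N => c kc; split=> //; [|split=> //]; lia.
Qed.
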